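(* Let $f:\mathbb{R}^n\to\mathbb{R}$ be convex and differentiable, let $g:\mathbb{R}^n\to\mathbb{R}$, and set $\zeta=f+g$. Assume: (i) $\zeta$ is coercive, i.e. $\zeta(\mathbf{x})\to\infty$ as $\|\mathbf{x}\|_2\to\infty$; (ii) $\zeta$ is bounded below; (iii) $g$ is proper, lower semicontinuous, finite-valued, weakly convex with modulus $\sigma_g>0$, and directionally differentiable; (iv) $\nabla f$ is Lipschitz continuous with constant $\mathrm{Lip}_{\nabla f}>0$, i.e. $\|\nabla f(\mathbf{x})-\nabla f(\mathbf{y})\|_2\le \mathrm{Lip}_{\nabla f}\|\mathbf{x}-\mathbf{y}\|_2$ for all $\mathbf{x},\mathbf{y}\in\mathbb{R}^n$. If $\rho>\max\{\sigma_g,\;1+\mathrm{Lip}_{\nabla f},\;\mathrm{Lip}_{\nabla f}(1+2\,\mathrm{Lip}_{\nabla f})\}$, then the sequence of iterates $\{(\mathbf{x}^t,\mathbf{z}^t,\mathbf{v}^t)\}_{t=1}^\infty$ generated by LADMM with parameter $\rho$ (from any initial point $(\mathbf{x}^0,\mathbf{z}^0,\mathbf{v}^0)$) has a subsequence converging to a limit $(\mathbf{x}^*,\mathbf{z}^*,\mathbf{v}^* )$ such that $\mathbf{x}^*$ is a d-stationary point of the problem $\min_{\mathbf{x}\in\mathbb{R}^n}\zeta(\mathbf{x})$.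
   Context: Weak convexity: $g$ is weakly convex with modulus $\sigma_g>0$ if $g(\mathbf{x})+\frac{\sigma_g}{2}\|\mathbf{x}\|_2^2$ is convex. Directional derivative: $h'(\mathbf{x};\mathbf{d})=\lim_{\tau\downarrow 0}\frac{h(\mathbf{x}+\tau\mathbf{d})-h(\mathbf{x})}{\tau}$; $h$ is directionally differentiable if this limit exists for all $\mathbf{x},\mathbf{d}$. d-stationary point: $\mathbf{x}^*\in\mathbb{R}^n$ is d-stationary (directional stationary) for $\min_{\mathbf{x}}\zeta(\mathbf{x})$ if $\zeta'(\mathbf{x}^*;\mathbf{x}-\mathbf{x}^* )\ge 0$ for all $\mathbf{x}\in\mathbb{R}^n$. Augmented Lagrangian, for $\rho>0$: $\mathcal{L}(\mathbf{x},\mathbf{z};\mathbf{v})=f(\mathbf{z})+g(\mathbf{x})+\rho\langle\mathbf{v},\mathbf{x}-\mathbf{z}\rangle+\frac{\rho}{2}\|\mathbf{x}-\mathbf{z}\|_2^2$ for $\mathbf{x},\mathbf{z},\mathbf{v}\in\mathbb{R}^n$. LADMM (linearized ADMM) iterations: given $(\mathbf{x}^0,\mathbf{z}^0,\mathbf{v}^0)$, for $t=0,1,2,\dots$, $\mathbf{x}^{t+1}\in\arg\min_{\mathbf{x}}\mathcal{L}(\mathbf{x},\mathbf{z}^t;\mathbf{v}^t)$, $\mathbf{z}^{t+1}\in\arg\min_{\mathbf{z}}\{f(\mathbf{z}^t)+\langle\nabla f(\mathbf{z}^t),\mathbf{z}-\mathbf{z}^t\rangle+\frac{\rho}{2}\|\mathbf{x}^{t+1}-\mathbf{z}+\mathbf{v}^t\|_2^2\}$,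 i.e. $\mathbf{z}^{t+1}=\mathbf{x}^{t+1}+\mathbf{v}^t-\frac{1}{\rho}\nabla f(\mathbf{z}^t)$, $\mathbf{v}^{t+1}=\mathbf{v}^t+\mathbf{x}^{t+1}-\mathbf{z}^{t+1}$. *)

(* Defs.v *)
(* Vectors of R^n are row vectors 'rV[R]_n over R : realType. *)
From HB Require Import structures.
From mathcomp Require Import all_boot all_order all_algebra.
From mathcomp Require Import all_classical all_reals all_analysis.

Set Implicit Arguments.
Unset Strict Implicit.
Unset Printing Implicit Defensive.

Import Order.TTheory GRing.Theory Num.Theory.
Import numFieldNormedType.Exports.

Local Open Scope classical_set_scope.
Local Open Scope ring_scope.

Definition dot (R : realType) (n : nat) (u v : 'rV[R]_n) : R :=
  \sum_(i < n) u 0 i * v 0 i.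

(* The library norm `|x| on 'rV[R]_n is the sup norm, hence this separate
   Euclidean norm; both induce the same topology. *)
Definition enorm (R : realType) (n : nat) (x : 'rV[R]_n) : R :=
  Num.sqrt (dot x x).

(* Meaningful only where h is differentiable: 'D_v h x has a default value
   when the limit does not exist. *)
Definition gradient (R : realType) (n : nat) (h : 'rV[R]_n -> R)
    (x : 'rV[R]_n) : 'rV[R]_n :=
  \row_(i < n) 'D_(delta_mx 0 i) h x.

Definition coercive (R : realType) (n : nat) (h : 'rV[R]_n -> R) : Prop :=
  forall M : R, exists r : R, forall x, r <= enorm x -> M <= h x.

Definition weakly_convex (R : realType) (n : nat) (sigma : R)
    (h : 'rV[R]_n -> R) : Prop :=
  convex_function [set: 'rV[R]_n]
    (fun x : 'rV[R]_n => h x + sigma / 2 * enorm x ^+ 2).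

Definition dir_quotient (R : realType) (n : nat) (h : 'rV[R]_n -> R)
    (x d : 'rV[R]_n) (tau : R) : R :=
  (h (x + tau *: d) - h x) / tau.

Definition dir_derive (R : realType) (n : nat) (h : 'rV[R]_n -> R)
    (x d : 'rV[R]_n) : R :=
  lim (dir_quotient h x d tau @[tau --> 0^'+]).

Definition dir_derivable (R : realType) (n : nat) (h : 'rV[R]_n -> R)
    (x d : 'rV[R]_n) : Prop :=
  cvg (dir_quotient h x d tau @[tau --> 0^'+]).

Definition directionally_differentiable (R : realType) (n : nat)
    (h : 'rV[R]_n -> R) : Prop :=
  forall x d, dir_derivable h x d.

(* Existence of the directional derivative is required explicitly, because
   lim takes a default value when the limit does not exist. *)
Definition d_stationary (R : realType) (n : nat) (h : 'rV[R]_n -> R)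
    (xs : 'rV[R]_n) : Prop :=
  forall x, dir_derivable h xs (x - xs) /\ 0 <= dir_derive h xs (x - xs).

Definition argmin (R : realType) (n : nat) (h : 'rV[R]_n -> R) :
    set 'rV[R]_n :=
  [set x | forall y, h x <= h y].

Definition augmented_lagrangian (R : realType) (n : nat)
    (f g : 'rV[R]_n -> R) (rho : R) (x z v : 'rV[R]_n) : R :=
  f z + g x + rho * dot v (x - z) + rho / 2 * enorm (x - z) ^+ 2.

Definition linearized_objective (R : realType) (n : nat)
    (f : 'rV[R]_n -> R) (rho : R) (x zt v z : 'rV[R]_n) : R :=
  f zt + dot (gradient f zt) (z - zt) + rho / 2 * enorm (x - z + v) ^+ 2.

Definition LADMM (R : realType) (n : nat) (f g : 'rV[R]_n -> R) (rho : R)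
    (x z v : nat -> 'rV[R]_n) : Prop :=
  forall t : nat,
    [/\ argmin (fun y => augmented_lagrangian f g rho y (z t) (v t)) (x t.+1),
        argmin (linearized_objective f rho (x t.+1) (z t) (v t)) (z t.+1)
      & v t.+1 = v t + x t.+1 - z t.+1].

(* Main.v *)
Require Import Defs.
From HB Require Import structures.
From mathcomp Require Import all_boot all_order all_algebra.
From mathcomp Require Import all_classical all_reals all_analysis.
From mathcomp Require Import ring lra.

Set Implicit Arguments.
Unset Strict Implicit.
Unset Printing Implicit Defensive.

Import Order.TTheory GRing.Theory Num.Theory.
Import numFieldNormedType.Exports.

Local Open Scope classical_set_scope.
Local Open Scope ring_scope.

(** Optimality of the linearized z-step says that v^{t+1} = grad f(z^t) / rho, so
    the dual variable is slaved to z and its increments are controlled by those of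
    z: rho |v^{t+1} - v^t| <= Lip |z^t - z^{t-1}|.  Along one iteration the
    augmented Lagrangian L_t does not increase in the x-step, loses
    (rho - Lip)/2 |z^{t+1} - z^t|^2 in the z-step ([descent_lemma]), and gains
    rho |v^{t+1} - v^t|^2 in the dual update.  The gain involves the previous
    z-step, so it is absorbed by the energy
      E_t = L_t + Lip^2 |z^t - z^{t-1}|^2,
    and the assumption on rho makes the remaining coefficient
    (rho - Lip)/2 - Lip^2 of |z^{t+1} - z^t|^2 positive
    ([lyapunov_decrease]).  Moreover zeta(x^t) <= E_t ([zeta_le_lyapunov]).

    Hence E_t decreases and is bounded below, which forces z^{t+1} - z^t, then
    v^{t+1} - v^t = x^{t+1} - z^{t+1}, to tend to 0; and zeta(x^t) stays bounded,
    so by coercivity the x^t are bounded and a subsequence of them converges to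
    some a.  Along it z^t and z^{t-1} also tend to a, while v^t and v^{t-1} tend
    to grad f(a) / rho ([iterates_subseq_cvg]).

    Finally the minimality of each x^t passes to the limit by lower semicontinuity
    of g ([argmin_augmented_lagrangian_limit]): for every y,
      g(a) <= g(y) + <grad f(a), y - a> + rho/2 |y - a|^2.
    Taking y = a + tau d, dividing by tau and letting tau go to 0 from the right
    leaves 0 <= g'(a; d) + <grad f(a), d>, which is the directional derivative of
    zeta ([d_stationary_of_prox_min]).

    Estimates are kept in terms of the squares dot u u: with Young's inequality in
    place of Cauchy-Schwarz, square roots appear only in the comparison with the
    topology. *)

(** * The dot product and the topology of row vectors *)

Section DotProduct.
Context {R : realType} {n : nat}.
Implicit Types u v w : 'rV[R]_n.

Lemma dotC u v : dot u v = dot v u.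
Proof. by apply: eq_bigr => i _; rewrite mulrC. Qed.

Lemma dotDl u v w : dot (u + v) w = dot u w + dot v w.
Proof. by rewrite -big_split; apply: eq_bigr => i _; rewrite mxE mulrDl. Qed.

Lemma dotZl a u v : dot (a *: u) v = a * dot u v.
Proof. by rewrite /dot mulr_sumr; apply: eq_bigr => i _; rewrite mxE mulrA. Qed.

Lemma dotDr u v w : dot w (u + v) = dot w u + dot w v.
Proof. by rewrite !(dotC w) dotDl. Qed.

Lemma dotZr a u v : dot v (a *: u) = a * dot v u.
Proof. by rewrite !(dotC v) dotZl. Qed.

Lemma dotNl u v : dot (- u) v = - dot u v.
Proof. by rewrite -scaleN1r dotZl mulN1r. Qed.

Lemma dotNr u v : dot v (- u) = - dot v u.
Proof. by rewrite !(dotC v) dotNl. Qed.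

Definition dotE := (dotDl, dotDr, dotNl, dotNr, dotZl, dotZr).

Lemma dot_ge0 u : 0 <= dot u u.
Proof. by apply: sumr_ge0 => i _; rewrite -expr2 sqr_ge0. Qed.

Lemma sqr_enorm u : enorm u ^+ 2 = dot u u.
Proof. by rewrite sqr_sqrtr ?dot_ge0. Qed.

Lemma enorm_ge0 u : 0 <= enorm u.
Proof. exact: sqrtr_ge0. Qed.

Lemma norm_le_enorm u : `|u| <= enorm u.
Proof.
have [->|] := eqVneq `|u| 0; first exact: enorm_ge0.
move=> /mx_norm_neq0[[i j]]; rewrite [`|u|]/Num.norm/= => ->.
rewrite ord1 -sqrtr_sqr ler_wsqrtr// expr2 /dot (bigD1 j)//= lerDl.
by apply: sumr_ge0 => k _; rewrite -expr2 sqr_ge0.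
Qed.

Lemma dot_eq0 u : dot u u = 0 -> u = 0.
Proof.
move=> u0; apply/normr0_eq0/eqP; rewrite eq_le normr_ge0 andbT.
by rewrite (le_trans (norm_le_enorm u))// /enorm u0 sqrtr0.
Qed.

(** Expansion of |c u - v|^2 >= 0, divided by c. *)
Lemma ler_dot_young (c : R) u v : 0 < c ->
  2 * dot u v <= c * dot u u + c^-1 * dot v v.
Proof.
move=> c0; have := dot_ge0 (c *: u - v); rewrite !dotE (dotC v u) => h.
rewrite -(ler_pM2l c0) mulrDr [X in _ <= _ + X]mulrA mulfV ?gt_eqF// mul1r.
by move: h; lra.
Qed.

Section Convergence.
Context {T : Type} {F : set_system T} {FF : Filter F}.
Implicit Types s t : T -> 'rV[R]_n.

Lemma cvg_dot s t u v : s @ F --> u -> t @ F --> v ->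
  dot (s x) (t x) @[x --> F] --> dot u v.
Proof.
move=> su tv; apply: cvg_big => [|i _]; first exact: add_continuous.
have coord r w : r @ F --> w -> r x 0 i @[x --> F] --> w 0 i.
  move=> rw; apply: (cvg_comp r (fun M : 'rV[R]_n => M 0 i) rw).
  exact: coord_continuous.
by apply: cvgM; exact: coord.
Qed.

(** Bridges squared Euclidean estimates and the topology, which is that of the
    sup norm; the Euclidean norm dominates it. *)
Lemma cvg_dot0 s : dot (s x) (s x) @[x --> F] --> 0 -> s @ F --> (0 : 'rV[R]_n).
Proof.
move=> s0; apply/norm_cvg0P.
have e0 : enorm (s x) @[x --> F] --> 0.
  rewrite -[X in _ --> X](@sqrtr0 R).
  by apply: (cvg_comp _ _ s0); exact: sqrt_continuous.
apply: (squeeze_cvgr _ (cvg_cst 0) e0).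
by near=> x; rewrite normr_ge0 norm_le_enorm.
Unshelve. all: by end_near. Qed.

End Convergence.
End DotProduct.

(** * Sequences: subsequences, sufficient decrease, semicontinuity *)

Section SequenceLemmas.
Context {R : realType}.

Lemma increasing_seq_cvgn (phi : nat -> nat) :
  increasing_seq phi -> phi @ \oo --> \oo.
Proof.
move=> phi_incr A [N _ NA]; exists N => // k /= Nk; apply: NA => /=.
apply: leq_trans Nk _; elim: k => // k /leq_ltn_trans; apply.
by rewrite (leqW_mono phi_incr).
Qed.

(** When increments vanish, a subsequence and its backward shift have the same
    limit.  This is how the limit of the z^t also becomes that of the z^{t-1}
    which enter the x-step. *)
Lemma subseq_pred_cvg {V : normedModType R} (u : nat -> V)
    (phi : nat -> nat) (a : V) :
  phi @ \oo --> \oo -> u t.+1 - u t @[t --> \oo] --> (0 : V) ->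
  u (phi k).+1 @[k --> \oo] --> a -> u (phi k) @[k --> \oo] --> a.
Proof.
move=> phi_oo du ua.
have -> : (fun k => u (phi k)) =
    (fun k => u (phi k).+1 - (u (phi k).+1 - u (phi k))).
  by apply/funext => k; rewrite subKr.
rewrite -[X in _ --> X]subr0; apply: cvgB => //.
exact: (cvg_comp phi (fun t => u t.+1 - u t) phi_oo).
Qed.

(** The indices are chosen one after the other, the k-th one past the previous
    and with its term within 1/(k+1) of the cluster point. *)
Lemma cluster_subseq_cvg {V : normedModType R} (u : nat -> V) (a : V) :
  cluster (u @ \oo) a ->
  exists2 phi : nat -> nat, increasing_seq phi & u \o phi @ \oo --> a.
Proof.
move=> clu.
have near_a (km : nat * nat) :
    exists p, (km.2 < p)%N /\ ball a km.1.+1%:R^-1 (u p).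
  have tail : (u @ \oo) (u @` [set p | (km.2 < p)%N]).
    by exists km.2.+1 => // p /= mp; exists p.
  have e0 : 0 < km.1.+1%:R^-1 :> R by rewrite invr_gt0 ltr0n.
  have [_ [[p mp <-] ap]] := clu _ _ tail (nbhsx_ballx a _ e0).
  by exists p.
have [next nextP] := choice near_a.
pose phi := fix phi k := if k is k'.+1 then next (k, phi k') else next (0, 0)%N.
exists phi.
  by apply/increasing_seqP => k; have [] := nextP (k.+1, phi k).
have phi_ball k : ball a k.+1%:R^-1 (u (phi k)).
  by case: k => [|k]; [have [] := nextP (0, 0)%N|have [] := nextP (k.+1, phi k)].
apply/cvgrPdist_lt => e e0; near=> k.
have := phi_ball k; rewrite -ball_normE /= => /lt_trans; apply.
by near: k; exact: (near_infty_natSinv_lt (PosNum e0)).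
Unshelve. all: by end_near. Qed.

Lemma bounded_rV_subseq_cvg {n : nat} (u : nat -> 'rV[R]_n) (r : R) :
  (forall k, `|u k| <= r) ->
  exists2 phi : nat -> nat, increasing_seq phi &
    exists a : 'rV[R]_n, u \o phi @ \oo --> a.
Proof.
move=> ur; pose A := [set y : 'rV[R]_n | `|y| <= r].
have Abounded : bounded_set A.
  by exists r; split=> [|M rM y /= yr]; [exact: num_real|exact: le_trans (ltW rM)].
have Aclosed : closed A.
  apply: (@closed_comp _ _ (fun y : 'rV[R]_n => `|y|) [set t | t <= r]).
    by move=> y _; exact: norm_continuous.
  exact: closed_le.
have uA : (u @ \oo) A by exists 0%N => // k _; exact: ur.
have [a [_ /cluster_subseq_cvg[phi phi_incr ua]]] :=
  bounded_closed_compact Abounded Aclosed (fmap_proper_filter u _) uA.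
by exists phi => //; exists a.
Qed.

(** A monotone bounded sequence converges, so its decrements, which dominate
    c * d, tend to 0. *)
Lemma sufficient_decrease_cvg0 (E d : nat -> R) (c : R) :
  0 < c -> (forall t, 0 <= d t) -> has_lbound (range E) ->
  (forall t, E t.+1 + c * d t.+1 <= E t) -> d @ \oo --> 0.
Proof.
move=> c0 d0 Elb Edec.
have cvgE : cvgn E.
  apply: nonincreasing_is_cvgn => //; apply/nonincreasing_seqP => t.
  by apply: le_trans (Edec t); rewrite lerDl mulr_ge0// ltW.
have ES : (E t - E t.+1) @[t --> \oo] --> 0.
  rewrite -(subrr (limn E)); apply: cvgB => //.
  by rewrite (cvg_shiftS E).
rewrite -cvg_shiftS.
have cES : c^-1 * (E t - E t.+1) @[t --> \oo] --> 0.
  by rewrite -(mulr0 c^-1); apply: (cvgM (cvg_cst _) ES).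
apply: (squeeze_cvgr _ (cvg_cst 0) cES).
by near=> t; rewrite d0/= ler_pdivlMl//; move: (Edec t); lra.
Unshelve. all: by end_near. Qed.

Lemma lower_semicontinuous_cvg_le {V : topologicalType} (g : V -> R)
    (u : nat -> V) (r : nat -> R) (a : V) (l : R) :
  lower_semicontinuous (EFin \o g) -> u @ \oo --> a -> r @ \oo --> l ->
  (forall k, g (u k) <= r k) -> g a <= l.
Proof.
move=> glsc ua rl gur; rewrite leNgt; apply/negP => lga.
pose m := (l + g a) / 2.
have [lm mg] : l < m /\ m < g a by rewrite /m; split; lra.
have [W aW Wg] : exists2 W, nbhs a W & forall y, W y -> (m%:E < (g y)%:E)%E.
  by apply: glsc; rewrite lte_fin.
suff : m <= l by rewrite leNgt lm.
apply: (cvgr_to_ge rl); near=> k.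
apply: le_trans (gur k); rewrite ltW// -lte_fin; apply: Wg.
by near: k; exact: ua.
Unshelve. all: by end_near. Qed.

End SequenceLemmas.

(** * Gradients, the descent lemma and directional derivatives *)

Section Gradient.
Context {R : realType} {n : nat}.
Implicit Types (f g : 'rV[R]_n -> R) (a b d : 'rV[R]_n).

Definition sqr_gradient_lipschitz f (Lip : R) : Prop := forall a b,
  dot (gradient f a - gradient f b) (gradient f a - gradient f b)
    <= Lip ^+ 2 * dot (a - b) (a - b).

Lemma derive_dot_gradient f a d :
  differentiable f a -> 'D_d f a = dot (gradient f a) d.
Proof.
move=> fa; rewrite deriveE// [in LHS](row_sum_delta d) linear_sum.
by apply: eq_bigr => i _; rewrite linearZ mxE deriveE// mulrC.
Qed.

(** The difference quotient of the restriction of f to a line is, at each point,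
    the quotient defining the derivative of f in the direction of the line. *)
Lemma is_derive_line f a d (s : R) : differentiable f (a + s *: d) ->
  is_derive s 1 (fun t : R => f (a + t *: d)) (dot (gradient f (a + s *: d)) d).
Proof.
move=> fs.
have line : (fun h : R => h^-1 *: (((fun t : R => f (a + t *: d)) \o shift s)
    (h *: 1) - f (a + s *: d))) =
  (fun h : R => h^-1 *: ((f \o shift (a + s *: d)) (h *: d) - f (a + s *: d))).
  apply/funext => h; congr (_ *: (f _ - _)).
  by rewrite /shift/= scalerDl [h *: 1]mulr1 addrCA.
apply: DeriveDef.
  by rewrite /derivable line; exact: diff_derivable.
by rewrite /derive line -derive_dot_gradient.
Qed.

Lemma gradient_diff_cvg0 f (Lip : R) {T : Type} {F : set_system T}
    {FF : Filter F} (u w : T -> 'rV[R]_n) :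
  sqr_gradient_lipschitz f Lip ->
  u x - w x @[x --> F] --> (0 : 'rV[R]_n) ->
  gradient f (u x) - gradient f (w x) @[x --> F] --> (0 : 'rV[R]_n).
Proof.
move=> gradLip uw0; apply: cvg_dot0.
have bound0 : Lip ^+ 2 * dot (u x - w x) (u x - w x) @[x --> F] --> 0.
  rewrite -[X in _ --> X](mulr0 (Lip ^+ 2)).
  apply: cvgM; first exact: cvg_cst.
  have -> : 0 = dot (0 : 'rV[R]_n) 0.
    by rewrite /dot big1// => i _; rewrite mxE mul0r.
  exact: cvg_dot.
apply: (squeeze_cvgr _ (cvg_cst 0) bound0).
by near=> x; rewrite dot_ge0 gradLip.
Unshelve. all: by end_near. Qed.

Lemma cvg_gradient f (Lip : R) {T : Type} {F : set_system T} {FF : Filter F}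
    (u : T -> 'rV[R]_n) a :
  sqr_gradient_lipschitz f Lip ->
  u @ F --> a -> gradient f (u x) @[x --> F] --> gradient f a.
Proof.
move=> gradLip ua; apply/subr_cvg0.
by apply: gradient_diff_cvg0 gradLip _; apply/subr_cvg0.
Qed.

(** On the segment from a to b, parametrized by s, the gap between f and its
    quadratic upper model vanishes at s = 0 and has nonpositive derivative, by
    Young's inequality with the weight 1 / (Lip s) that balances both terms. *)
Lemma descent_lemma f (Lip : R) a b : 0 < Lip ->
  (forall x, differentiable f x) ->
  sqr_gradient_lipschitz f Lip ->
  f b <= f a + dot (gradient f a) (b - a) + Lip / 2 * dot (b - a) (b - a).
Proof.
move=> Lip0 fdiff gradLip; set d := b - a.
pose gap (s : R) :=
  f (a + s *: d) - (s * dot (gradient f a) d + Lip / 2 * s ^+ 2 * dot d d).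
pose dgap (s : R) :=
  dot (gradient f (a + s *: d)) d - (dot (gradient f a) d + Lip * s * dot d d).
have gapD (s : R) : is_derive s 1 gap (dgap s).
  apply: is_deriveB; first exact: is_derive_line.
  apply: is_derive_eq; rewrite /= !scaler0 !add0r /GRing.scale/=.
  by field.
have dgap_le0 s : 0 < s -> dgap s <= 0.
  move=> s0; have Ls0 : 0 < (Lip * s)^-1 by rewrite invr_gt0 mulr_gt0.
  have := ler_dot_young (gradient f (a + s *: d) - gradient f a) d Ls0.
  have := gradLip (a + s *: d) a; rewrite (addrC a) addrK !(dotZl, dotZr).
  rewrite -(ler_pM2l Ls0) invrK.
  have -> : (Lip * s)^-1 * (Lip ^+ 2 * (s * (s * dot d d))) =
            Lip * s * dot d d by field; rewrite !gt_eqF.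
  by rewrite (dotDl _ _ d) (dotNl _ d) (addrC (s *: d)) /dgap; lra.
have : gap 1 <= gap 0.
  have gap_derivable (s : R) : derivable gap s 1 by have [] := gapD s.
  apply: (@ler0_derive1_le_cc R gap 0 1); rewrite ?in_itv/= ?lexx ?ler01//.
    move=> s; rewrite in_itv/= => /andP[s0 _].
    by rewrite derive1E derive_val dgap_le0.
  by apply: derivable_within_continuous.
rewrite /gap scale1r scale0r addr0 (addrC a) subrK; lra.
Qed.

Lemma dir_quotient_derive f a d : differentiable f a ->
  dir_quotient f a d tau @[tau --> 0^'+] --> dot (gradient f a) d.
Proof.
move=> fa; apply: cvg_dnbhs_at_right.
rewrite -derive_dot_gradient// /derive.
have -> : dir_quotient f a d =
    fun h => h^-1 *: ((f \o shift a) (h *: d) - f a).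
  by apply/funext => h; rewrite /dir_quotient mulrC (addrC a).
exact: diff_derivable.
Qed.

(** A proximal term c |y - a|^2 is of second order at a, so it does not affect
    directional derivatives: minimality up to such a term is enough. *)
Lemma d_stationary_of_prox_min f g (c : R) a :
  differentiable f a -> directionally_differentiable g ->
  (forall y, g a <= g y + dot (gradient f a) (y - a) + c * dot (y - a) (y - a)) ->
  d_stationary (f \+ g) a.
Proof.
move=> fa gdir amin y; set d := y - a; set G := gradient f a.
have quotD : dir_quotient (f \+ g) a d =
    fun tau => dir_quotient f a d tau + dir_quotient g a d tau.
  by apply/funext => tau; rewrite /dir_quotient -mulrDl /=; congr (_ / _); ring.
have fgd : dir_quotient (f \+ g) a d tau @[tau --> 0^'+] -->
    dot G d + dir_derive g a d.
  by rewrite quotD; apply: cvgD; [exact: dir_quotient_derive|exact: gdir].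
split; first by apply/cvg_ex; eexists; exact: fgd.
rewrite /dir_derive (cvg_lim _ fgd)//.
have lowD : dir_quotient g a d tau + (dot G d + c * dot d d * tau)
    @[tau --> 0^'+] --> dir_derive g a d + (dot G d + c * dot d d * 0).
  apply: cvgD; first exact: gdir.
  apply: cvgD; first exact: cvg_cst.
  apply: cvgM; first exact: cvg_cst.
  exact: (@cvg_at_right_filter _ _ id 0 0 cvg_id).
rewrite addrC -[X in _ + X]addr0 -[X in _ + (_ + X)](mulr0 (c * dot d d)).
apply: (cvgr_to_ge lowD); near=> tau.
have tau0 : 0 < tau by [].
have := amin (a + tau *: d); rewrite (addrC a) addrK (addrC _ a) !(dotZl, dotZr).
rewrite -/G => h; rewrite /dir_quotient -(pmulr_rge0 _ tau0) !mulrDr mulrCA.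
rewrite mulfV ?gt_eqF// mulr1; move: h; lra.
Unshelve. all: by end_near. Qed.

End Gradient.

(** * One LADMM iteration, and the Lyapunov function *)

Section LADMMSteps.
Context {R : realType} {n : nat}.
Variables (f g : 'rV[R]_n -> R) (Lip rho : R).
Hypotheses (Lip_gt0 : 0 < Lip) (rho_gt0 : 0 < rho).
Hypothesis f_diff : forall a, differentiable f a.
Hypothesis gradLip : sqr_gradient_lipschitz f Lip.
Implicit Types x z v : 'rV[R]_n.

(** The linearized objective is a constant plus rho/2 |w - grad f(zt) / rho|^2
    in the variable w = v + x - z, which is the updated dual variable. *)
Lemma argmin_linearized_objective x zt v z :
  argmin (linearized_objective f rho x zt v) z ->
  v + x - z = rho^-1 *: gradient f zt.
Proof.
rewrite /argmin /linearized_objective /= => zmin.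
have GE : gradient f zt = rho *: (rho^-1 *: gradient f zt).
  by rewrite scalerA mulfV ?scale1r ?gt_eqF.
move: (rho^-1 *: _) GE => u GE; have := zmin (x + v - u).
rewrite GE !sqr_enorm {zmin GE}.
have -> : x - (x + v - u) + v = u by apply/rowP => i; rewrite !mxE; ring.
have -> : x - z + v = v + x - z by apply/rowP => i; rewrite !mxE; ring.
have -> : z - zt = x + v - zt - (v + x - z).
  by apply/rowP => i; rewrite !mxE; ring.
have -> : x + v - u - zt = x + v - zt - u by rewrite addrAC.
move: (v + x - z) (x + v - zt) => w p wmin.
apply/subr0_eq/dot_eq0/eqP; rewrite eq_le dot_ge0 andbT.
rewrite -(pmulr_rle0 _ rho_gt0).
by move: wmin; rewrite !dotE (dotC w u); lra.
Qed.

(** Effect of the z-step and the dual update together.  Since rho v' is the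
    gradient at z, the first-order terms of the descent lemma cancel against the
    coupling term exactly. *)
Lemma augmented_lagrangian_step x z v z' v' :
  v' = v + x - z' -> v' = rho^-1 *: gradient f z ->
  augmented_lagrangian f g rho x z' v' <=
    augmented_lagrangian f g rho x z v + rho * dot (v' - v) (v' - v)
    - (rho - Lip) / 2 * dot (z' - z) (z' - z).
Proof.
move=> v'E v'G; rewrite /augmented_lagrangian !sqr_enorm.
have := descent_lemma z z' Lip_gt0 f_diff gradLip.
have -> : gradient f z = rho *: v'.
  by rewrite v'G scalerA mulfV ?scale1r ?gt_eqF.
have -> : x - z' = v' - v by rewrite v'E; apply/rowP => i; rewrite !mxE; ring.
have -> : x - z = (v' - v) + (z' - z).
  by rewrite v'E; apply/rowP => i; rewrite !mxE; ring.
rewrite !dotE (dotC v' v) (dotC z' z) (dotC z v) (dotC z' v) (dotC z v').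
rewrite (dotC z' v'); lra.
Qed.

(** At a dual variable of the form grad f(zp) / rho, the coupling term is the
    linearization of f with the gradient taken at zp instead of z.  Young's
    inequality trades the error for |z - zp|^2 and half of |x - z|^2; the latter
    and the descent-lemma term are covered by the penalty since rho >= 1 + Lip. *)
Lemma zeta_le_augmented_lagrangian x z zp : 1 + Lip <= rho ->
  f x + g x <= augmented_lagrangian f g rho x z (rho^-1 *: gradient f zp)
               + Lip ^+ 2 / 2 * dot (z - zp) (z - zp).
Proof.
move=> rho_ge; rewrite /augmented_lagrangian sqr_enorm dotZl mulrA mulfV ?gt_eqF//.
have := descent_lemma z x Lip_gt0 f_diff gradLip.
have := ler_dot_young (gradient f z - gradient f zp) (x - z) ltr01.
have := gradLip z zp; rewrite invr1 [dot (gradient _ _ - _) (x - z)]dotDl dotNl.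
have : 0 <= (rho - (1 + Lip)) * dot (x - z) (x - z).
  by rewrite mulr_ge0 ?dot_ge0 ?subr_ge0.
lra.
Qed.

End LADMMSteps.

Section LADMMIterates.
Context {R : realType} {n : nat}.
Variables (f g : 'rV[R]_n -> R) (Lip rho : R) (x z v : nat -> 'rV[R]_n).
Hypotheses (Lip_gt0 : 0 < Lip) (rho_gt : 1 + Lip < rho).
Hypothesis rho_gt2 : Lip * (1 + 2 * Lip) < rho.
Hypothesis f_diff : forall a, differentiable f a.
Hypothesis gradLip : sqr_gradient_lipschitz f Lip.
Hypothesis zeta_lb : has_lbound (range (f \+ g)).
Hypothesis zeta_coercive : coercive (f \+ g).
Hypothesis iterates : LADMM f g rho x z v.

Let rho_gt1 : 1 < rho. Proof. by move: Lip_gt0 rho_gt; lra. Qed.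
Let rho_gt0 : 0 < rho. Proof. exact: lt_trans ltr01 rho_gt1. Qed.

Let step (t : nat) := dot (z t.+1 - z t) (z t.+1 - z t).

(** The weight Lip^2 leaves room on both sides: it exceeds the Lip^2 / rho
    which pays for the dual increase, and the Lip^2 / 2 of
    [zeta_le_augmented_lagrangian], while staying below (rho - Lip) / 2.  The
    index is shifted by one because v^0 is arbitrary: the dual variable is
    a gradient only from the first iteration on. *)
Definition lyapunov (t : nat) : R :=
  augmented_lagrangian f g rho (x t.+1) (z t.+1) (v t.+1)
  + Lip ^+ 2 * dot (z t.+1 - z t) (z t.+1 - z t).

Lemma dual_iterate t : v t.+1 = rho^-1 *: gradient f (z t).
Proof.
have [_ zmin ->] := iterates t; exact: argmin_linearized_objective zmin.
Qed.

Lemma dual_step_le t :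
  rho ^+ 2 * dot (v t.+2 - v t.+1) (v t.+2 - v t.+1) <= Lip ^+ 2 * step t.
Proof.
rewrite !dual_iterate -scalerBr dotZl dotZr mulrA mulrA expr2.
by rewrite mulfK ?gt_eqF// mulfV ?gt_eqF// mul1r; exact: gradLip.
Qed.

Lemma lyapunov_decrease t :
  lyapunov t.+1 + ((rho - Lip) / 2 - Lip ^+ 2) * step t.+1 <= lyapunov t.
Proof.
have [xmin _ vE] := iterates t.+1.
have := xmin (x t.+1).
have := augmented_lagrangian_step g Lip_gt0 rho_gt0 f_diff gradLip vE (dual_iterate _).
have : rho * dot (v t.+2 - v t.+1) (v t.+2 - v t.+1) <= Lip ^+ 2 * step t.
  apply: (le_trans _ (dual_step_le t)).
  by apply: ler_wpM2r; [exact: dot_ge0|rewrite expr2 ler_peMl// ltW].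
rewrite /lyapunov /step; lra.
Qed.

Lemma zeta_le_lyapunov t : f (x t.+1) + g (x t.+1) <= lyapunov t.
Proof.
rewrite /lyapunov dual_iterate.
apply: le_trans (zeta_le_augmented_lagrangian g Lip_gt0 rho_gt0 f_diff gradLip
  (x t.+1) (z t.+1) (z t) (ltW rho_gt)) _.
rewrite lerD2l ler_wpM2r ?dot_ge0//.
by have := sqr_ge0 Lip; lra.
Qed.

Lemma primal_step_cvg0 : z t.+1 - z t @[t --> \oo] --> (0 : 'rV[R]_n).
Proof.
apply: cvg_dot0.
apply: (@sufficient_decrease_cvg0 _ lyapunov step ((rho - Lip) / 2 - Lip ^+ 2)).
- by move: rho_gt2; rewrite expr2; lra.
- by move=> t; exact: dot_ge0.
- have [m mlb] := zeta_lb; exists m => _ [t _ <-].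
  by apply: le_trans (zeta_le_lyapunov t); apply: mlb; exists (x t.+1).
- exact: lyapunov_decrease.
Qed.

Lemma primal_residual t : x t.+1 - z t.+1 = v t.+1 - v t.
Proof.
by have [_ _ ->] := iterates t; apply/rowP => i; rewrite !mxE; ring.
Qed.

Lemma dual_step_cvg0 : v t.+1 - v t @[t --> \oo] --> (0 : 'rV[R]_n).
Proof.
rewrite -cvg_shiftS; under eq_fun do rewrite !dual_iterate -scalerBr.
rewrite -(scaler0 _ rho^-1); apply: cvgZ; first exact: cvg_cst.
exact: gradient_diff_cvg0 gradLip primal_step_cvg0.
Qed.

(** Indices start at 2 so that the preceding iterate, which the x-step refers to,
    already has its dual variable given by a gradient. *)
Lemma iterates_subseq_cvg : exists psi : nat -> nat, exists a : 'rV[R]_n,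
  [/\ increasing_seq psi,
      x (psi k).+2 @[k --> \oo] --> a,
      z (psi k).+2 @[k --> \oo] --> a /\ z (psi k).+1 @[k --> \oo] --> a &
      v (psi k).+2 @[k --> \oo] --> rho^-1 *: gradient f a /\
      v (psi k).+1 @[k --> \oo] --> rho^-1 *: gradient f a].
Proof.
have [r zeta_gt] := zeta_coercive (lyapunov 0 + 1).
have xr t : `|x t.+2| <= r.
  apply: le_trans (norm_le_enorm _) _; rewrite leNgt; apply/negP => /ltW/zeta_gt.
  apply/negP; rewrite -ltNge (le_lt_trans (zeta_le_lyapunov t.+1))//.
  apply: le_lt_trans (_ : lyapunov 0 < _); last by rewrite ltrDl.
  elim: t.+1 => // s; apply: le_trans; apply: le_trans (lyapunov_decrease s).
  rewrite lerDl mulr_ge0 ?dot_ge0//.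
  by move: rho_gt2; rewrite expr2; lra.
have [psi psi_incr [a xa]] := bounded_rV_subseq_cvg xr.
have psi_oo : (fun k => (psi k).+1) @ \oo --> \oo.
  apply: (cvg_comp psi (fun k => k.+1) (increasing_seq_cvgn psi_incr)).
  by under eq_fun do rewrite -addn1; exact: cvg_addnr.
have za : z (psi k).+2 @[k --> \oo] --> a.
  have -> : (fun k => z (psi k).+2) =
      (fun k => x (psi k).+2 - (v (psi k).+2 - v (psi k).+1)).
    by apply/funext => k; rewrite -primal_residual subKr.
  rewrite -[X in _ --> X]subr0; apply: cvgB => //.
  exact: (cvg_comp _ (fun t => v t.+1 - v t) psi_oo dual_step_cvg0).
have zpa := subseq_pred_cvg psi_oo primal_step_cvg0 za.
have va : v (psi k).+2 @[k --> \oo] --> rho^-1 *: gradient f a.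
  under eq_fun do rewrite dual_iterate.
  by apply: cvgZ; [exact: cvg_cst|exact: cvg_gradient gradLip zpa].
have vpa := subseq_pred_cvg psi_oo dual_step_cvg0 va.
by exists psi, a; split=> //; split.
Qed.

End LADMMIterates.

(** * Passing to the limit *)

(** In the inequality expressing the minimality of x k against y, every term but
    g (x k) is continuous, and lower semicontinuity has the right direction for
    that one.  The penalty at x k vanishes because x k and z k share their
    limit. *)
Lemma argmin_augmented_lagrangian_limit {R : realType} {n : nat}
    (f g : 'rV[R]_n -> R) (rho : R) (x z v : nat -> 'rV[R]_n) (a b : 'rV[R]_n) :
  lower_semicontinuous (EFin \o g) ->
  (forall k, argmin (fun y => augmented_lagrangian f g rho y (z k) (v k)) (x k)) ->
  x @ \oo --> a -> z @ \oo --> a -> v @ \oo --> b ->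
  forall y, g a <= g y + rho * dot b (y - a) + rho / 2 * dot (y - a) (y - a).
Proof.
move=> glsc xmin xa za vb y.
pose bound k := g y + rho * dot (v k) (y - x k)
  + rho / 2 * (dot (y - z k) (y - z k) - dot (x k - z k) (x k - z k)).
have dot00 : dot (a - a) (a - a) = 0.
  by rewrite subrr /dot big1// => i _; rewrite mxE mul0r.
rewrite -[X in rho / 2 * X]subr0 -[in X in _ + X]dot00.
apply: (lower_semicontinuous_cvg_le (r := bound) glsc xa) => [|k].
- have cst w : (fun=> w : 'rV[R]_n) @ \oo --> w by exact: cvg_cst.
  have yz : y - z k @[k --> \oo] --> y - a by exact: cvgB.
  have xz : x k - z k @[k --> \oo] --> a - a by exact: cvgB.
  have yx : y - x k @[k --> \oo] --> y - a by exact: cvgB.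
  apply: cvgD; first apply: cvgD; first exact: cvg_cst.
  + by apply: cvgM; [exact: cvg_cst|exact: cvg_dot].
  + apply: cvgM; first exact: cvg_cst.
    by apply: cvgB; exact: cvg_dot.
- have := xmin k y; rewrite /augmented_lagrangian !sqr_enorm /bound.
  have -> : y - x k = (y - z k) - (x k - z k).
    by apply/rowP => i; rewrite !mxE; ring.
  by rewrite [dot (v k) (_ - _ - _)]dotDr dotNr; lra.
Qed.

Theorem theorem4 (R : realType) (n : nat) (f g : 'rV[R]_n -> R)
    (sigma Lip rho : R) (x z v : nat -> 'rV[R]_n)
    (f_convex : convex_function [set: 'rV[R]_n] f)
    (f_diff : forall a, differentiable f a)
    (zeta_coercive : coercive (f \+ g))
    (zeta_bounded_below : has_lbound (range (f \+ g)))
    (g_lsc : lower_semicontinuous (EFin \o g))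
    (sigma_gt0 : 0 < sigma)
    (g_weakly_convex : weakly_convex sigma g)
    (g_dir_diff : directionally_differentiable g)
    (Lip_gt0 : 0 < Lip)
    (grad_Lipschitz : forall a b,
       enorm (gradient f a - gradient f b) <= Lip * enorm (a - b))
    (rho_large :
       Num.max sigma (Num.max (1 + Lip) (Lip * (1 + 2 * Lip))) < rho)
    (iterates : LADMM f g rho x z v) :
  exists phi : nat -> nat,
    [/\ increasing_seq phi,
        forall k, (0 < phi k)%N
      & exists xs zs vs : 'rV[R]_n,
          (x (phi k), z (phi k), v (phi k)) @[k --> \oo] --> (xs, zs, vs) /\
          d_stationary (f \+ g) xs].
Proof.
have [_ [rho_gt1 rho_gt2]] : sigma < rho /\ 1 + Lip < rho /\
    Lip * (1 + 2 * Lip) < rho.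
  by move: rho_large; rewrite !gt_max => /and3P[].
have rho_gt0 : 0 < rho by move: Lip_gt0 rho_gt1; lra.
have gradLip : sqr_gradient_lipschitz f Lip.
  move=> a b; rewrite -!sqr_enorm -exprMn lerXn2r// nnegrE ?enorm_ge0//.
  by rewrite mulr_ge0 ?enorm_ge0 ?ltW.
have [psi [a [psi_incr xa [za zpa] [va vpa]]]] := iterates_subseq_cvg Lip_gt0
  rho_gt1 rho_gt2 f_diff gradLip zeta_bounded_below zeta_coercive iterates.
exists (fun k => (psi k).+2); split=> //.
exists a, a, (rho^-1 *: gradient f a); split.
  have xza : (x (psi k).+2, z (psi k).+2) @[k --> \oo] --> (a, a).
    exact: (cvg_pair xa za).
  exact: (cvg_pair xza va).
apply: (d_stationary_of_prox_min (c := rho / 2)) => // y.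
have xmin k : argmin (fun y => augmented_lagrangian f g rho y
    (z (psi k).+1) (v (psi k).+1)) (x (psi k).+2) by have [] := iterates (psi k).+1.
have := argmin_augmented_lagrangian_limit g_lsc xmin xa zpa vpa y.
by rewrite dotZl mulrA mulfV ?gt_eqF// mul1r.
Qed.
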